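(* Let $G$ be a graph. Then $G$ is a monoid Cayley graph of a group (that is, $G=\mathcal{C}\langle M,Q\rangle$ for some group $M$, some subset $Q\subseteq M$ generating $M$ as a monoid, i.e. every element of $M$ is a finite product of elements of $Q$, and some injective labeling $\langle\,\rangle:Q\to A$) if and only if $G$ is rooted, simple, deterministic and symmetric.
   Context: A graph is a non-empty set $G\subseteq V\times A\times V$ of labeled edges $s\xrightarrow{a}_G t$; $V_G$ is the set of vertices occurring in edges. For a magma $(M,\cdot)$, $Q\subseteq M$ and injective $\langle\,\rangle:Q\to A$, $\mathcal{C}\langle M,Q\rangle=\{(p,\langle q\rangle,p\cdot q): p\in M,\ q\in Q\}$. $G$ is rooted if some vertex reaches every vertex by a directed path; simple if no two edges share source and target; deterministic if $r\xrightarrow{a}s$, $r\xrightarrow{a}t$ imply $s=t$; symmetric (vertex-transitive) if for all $s,t\in V_G$ there is an automorphism of the labeled graph $G$ mapping $s$ to $t$. *)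

(* Defs.v *)
From Stdlib Require Export Relations.Relation_Operators.
From HB Require Import structures.
From mathcomp Require Export all_boot.
From mathcomp Require Export boolp classical_sets functions.

Set Implicit Arguments.
Unset Strict Implicit.
Unset Printing Implicit Defensive.

Local Open Scope classical_set_scope.

(* A labelled graph is given by its set of edges (source, label, target); there
   are no isolated vertices. Nonemptiness is a separate hypothesis. *)
Definition graph (V A : Type) := set (V * A * V).

Section GraphProperties.
Variables (V A : Type) (G : graph V A).

Definition vertices : set V :=
  [set s | exists a t, G (s, a, t) \/ G (t, a, s)].

Definition edge (s t : V) : Prop := exists a, G (s, a, t).

Definition rooted_graph : Prop :=
  exists2 r, vertices r & forall t, vertices t -> clos_refl_trans V edge r t.

Definition simple_graph : Prop :=
  forall s t a b, G (s, a, t) -> G (s, b, t) -> a = b.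

Definition deterministic_graph : Prop :=
  forall r a s t, G (r, a, s) -> G (r, a, t) -> s = t.

(* Only the restriction of [h] to the vertices matters. *)
Definition graph_automorphism (h : V -> V) : Prop :=
  set_bij vertices vertices h /\
  forall s a t, vertices s -> vertices t -> (G (s, a, t) <-> G (h s, a, h t)).

Definition symmetric_graph : Prop :=
  forall s t, vertices s -> vertices t ->
    exists2 h, graph_automorphism h & h s = t.

End GraphProperties.

Definition cayley (A : Type) (M : magmaType) (Q : set M) (lab : Q -> A) :
    graph M A :=
  [set e | exists (p : M) (q : Q), e = (p, lab q, (p * set_val q)%g)].

(* A graph whose vertices form a subset [M] of [V], seen as a graph over [V]. *)
Definition graph_incl (V A : Type) (M : set V) (H : graph M A) : graph V A :=
  [set (set_val e.1.1, e.1.2, set_val e.2) | e in H].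

(* The empty product, [s = [::]], is allowed. *)
Definition generates_monoid (M : monoidType) (Q : set M) : Prop :=
  forall x : M, exists2 s : seq M,
    {in s, forall y, Q y} & x = (\prod_(y <- s) y)%g.

(* The equality [G = C<M,Q>] is literal: the carrier of the group [M] is a
   subset of [V], with its own group law [gM]. *)
Definition group_monoid_cayley (V A : Type) (G : graph V A) : Prop :=
  exists (M : set V) (gM : Group M),
    let grM : groupType := Group.Pack gM in
    exists (Q : set grM) (lab : Q -> A),
      [/\ generates_monoid Q, injective lab & G = graph_incl (cayley lab)].

(* Main.v *)
(* A directed path from r determines where an edge-preserving map sends its
   endpoint once the image of r is known, because G is deterministic. Hence the
   automorphisms of a rooted, deterministic, symmetric graph act regularly on the
   vertices: writing h_s for the automorphism sending the root r to s, the law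
   s * t = h_s(t) makes the vertices a group with unit r. Its generators are the
   out-neighbours of r, each labelled by its unique edge from r. *)
Require Import Defs.
From HB Require Import structures.
Local Open Scope classical_set_scope.

(** Equality and choice on the bare type [T] come from classical axioms, and the left inverse law
    follows from the right one. The two equations keep the packed structure tied to [mul] and
    [one]. *)
Lemma group_structure {T : Type} {mul : T -> T -> T} {one : T} {inv : T -> T} :
  associative mul -> left_id one mul -> right_id one mul ->
  right_inverse one inv mul ->
  exists gT : Group T, let gr : groupType := Group.Pack gT in
    (forall x y : gr, (x * y)%g = mul x y) /\ (1%g : gr) = one.
Proof.
move=> mulA mul1 mulr1 mulV.
have Vmul : left_inverse one inv mul.
  move=> x; rewrite -[LHS]mulr1 -(mulV (inv x)) mulA -(mulA (inv x)) mulV.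
  by rewrite mulr1 mulV.
pose C : choiceType := HB.pack T (gen_eqMixin T) (gen_choiceMixin T).
pose gT : groupType :=
  HB.pack (Choice.sort C) (@isGroup.Build C one inv mul mulA mul1 mulr1 Vmul mulV).
by exists (Group.class gT).
Qed.

Section CayleyGraph.
Variables (V A : Type) (M : set V) (gM : Group M).
Let grM : groupType := Group.Pack gM.
Variables (Q : set grM) (lab : Q -> A).

Let toV (x : grM) : V := @set_val V M x.
Let fromV (v : V) : option grM := insub v.
Let C : graph V A := graph_incl (cayley lab).

Let toVK : pcancel toV fromV. Proof. exact: (@valK _ _ M). Qed.

Let toV_inj : injective toV. Proof. exact: pcan_inj toVK. Qed.

Let edgeP s a t : C (s, a, t) <->
  exists (p : grM) (q : Q), [/\ s = toV p, a = lab q & t = toV (p * set_val q)%g].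
Proof.
split=> [[_ [p [q ->]]] [<- <- <-]|[p [q [-> -> ->]]]]; first by exists p, q.
by exists (p, lab q, (p * set_val q)%g) => //; exists p, q.
Qed.

Let edge_labP (p : grM) q : C (toV p, lab q, toV (p * set_val q)%g).
Proof. by apply/edgeP; exists p, q. Qed.

Let vertexP s : vertices C s -> exists p, s = toV p.
Proof.
by case=> a [t [/edgeP[p [q [-> _ _]]]|/edgeP[p [q [_ _ ->]]]]]; eexists.
Qed.

(** Any edge of [C] supplies a generator, which then labels an edge leaving [p]. *)
Let vertex_toV (p : grM) : C !=set0 -> vertices C (toV p).
Proof.
by case=> -[[s a] t] /edgeP[_ [q _]]; do 2!eexists; left; exact: edge_labP q.
Qed.

(** A word in [Q] spells a path from the unit to its product. The induction removes the last letter,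
    since edges multiply on the right. *)
Lemma cayley_rooted : C !=set0 -> generates_monoid Q -> rooted_graph C.
Proof.
move=> C0 genQ; exists (toV 1%g); first exact: vertex_toV.
move=> _ /vertexP[x ->]; have [s sQ ->] := genQ x.
elim/last_ind: s sQ => [|s y IHs] sQ; first by rewrite big_nil; exact: rt_refl.
rewrite -cats1 big_cat big_seq1.
apply: rt_trans (IHs _) (rt_step _ _ _ _ _) => [z zs|].
  by apply: sQ; rewrite mem_rcons inE zs orbT.
have /mem_set Qy : Q y by apply: sQ; rewrite mem_rcons mem_head.
by eexists; exact: (edge_labP _ (SigSub Qy)).
Qed.

Lemma cayley_simple : simple_graph C.
Proof.
move=> s t a b /edgeP[p [q [-> -> ->]]] /edgeP[p' [q' [/toV_inj <- ->]]].
by move=> /toV_inj /mulgI /val_inj ->.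
Qed.

Lemma cayley_deterministic : injective lab -> deterministic_graph C.
Proof.
move=> lab_inj r a s t /edgeP[p [q [-> -> ->]]] /edgeP[p' [q' [/toV_inj <-]]].
by move=> /lab_inj <- ->.
Qed.

(** Left translations commute with right multiplication by generators, and the one by [y * x^-1]
    sends [x] to [y]. *)
Lemma cayley_symmetric : C !=set0 -> symmetric_graph C.
Proof.
move=> C0 _ _ /vertexP[x ->] /vertexP[y ->].
pose c := (y * x^-1)%g.
(* The value outside [M] is arbitrary: every vertex is some [toV z]. *)
pose h v := if fromV v is Some z then toV (c * z)%g else v.
have hE z : h (toV z) = toV (c * z)%g by rewrite /h toVK.
exists h; last by rewrite hE mulgVK.
split; first split.
- by move=> _ /vertexP[z ->]; rewrite hE; exact: vertex_toV.
- move=> v w /set_mem/vertexP[z ->] /set_mem/vertexP[z' ->].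
  by rewrite !hE => /toV_inj /mulgI ->.
- move=> _ /vertexP[z ->]; exists (toV (c^-1 * z)%g); first exact: vertex_toV.
  by rewrite hE mulVKg.
- move=> _ a _ /vertexP[z ->] /vertexP[z' ->]; rewrite !hE; split.
    move=> /edgeP[p [q [/toV_inj -> -> /toV_inj ->]]].
    by rewrite mulgA; exact: edge_labP.
  move=> /edgeP[p [q [/toV_inj <- -> /toV_inj]]].
  by rewrite -(mulgA c) => /mulgI ->; exact: edge_labP.
Qed.

End CayleyGraph.

Section RegularAction.
Variables (V A : Type) (G : graph V A).

Lemma edge_vertices {s a t} : G (s, a, t) -> vertices G s /\ vertices G t.
Proof. by move=> Gst; split; exists a; [exists t; left|exists s; right]. Qed.

Lemma automorphism_edge {h s a t} :
  graph_automorphism G h -> G (s, a, t) -> G (h s, a, h t).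
Proof.
move=> [_ hG] Gst; have [sV tV] := edge_vertices Gst.
exact: (hG s a t sV tV).1.
Qed.

(** Asking only for preservation of edges lets this apply directly to composites and to the
    identity. *)
Lemma edge_preserving_unique {f g : V -> V} {s t} : deterministic_graph G ->
  (forall s a t, G (s, a, t) -> G (f s, a, f t)) ->
  (forall s a t, G (s, a, t) -> G (g s, a, g t)) ->
  clos_refl_trans V (edge G) s t -> f s = g s -> f t = g t.
Proof.
move=> detG fG gG; elim=> // [x y [a xy] fgx|x y z _ IHxy _ IHyz /IHxy/IHyz//].
by apply: detG (fG _ _ _ xy) _; rewrite fgx; exact: gG.
Qed.

Lemma regular_group_monoid_cayley : rooted_graph G -> simple_graph G ->
  deterministic_graph G -> symmetric_graph G -> group_monoid_cayley G.
Proof.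
move=> [r rV rG] simG detG symG.
pose T : Type := vertices G.
have TV (x : T) : vertices G (set_val x) by exact: set_valP.
have mkT v : vertices G v -> {x : T | set_val x = v}.
  by move=> vV; exists (SigSub (mem_set vV)).
have /choice[h hP] (x : T) :
    exists f, graph_automorphism G f /\ f r = set_val x.
  by have [f ? ?] := symG _ _ rV (TV x); exists f.
have hE x s a t : G (s, a, t) -> G (h x s, a, h x t).
  by apply: automorphism_edge; case: (hP x).
have hr x : h x r = set_val x by case: (hP x).
have hV x v : vertices G v -> vertices G (h x v).
  by case: (hP x) => -[[+ _ _] _] _; exact.
pose mul (x y : T) : T := sval (mkT _ (hV x _ (TV y))).
have mulE x y : set_val (mul x y) = h x (set_val y) by exact: svalP (mkT _ _).
have [one oneE] := mkT r rV.
(* Both sides preserve edges and send [r] to [mul x y]; associativity is this identity at a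
   vertex. *)
have hM x y v : vertices G v -> h (mul x y) v = h x (h y v).
  move=> vV; apply: (edge_preserving_unique (g := h x \o h y) detG _ _ (rG v vV)).
  - exact: hE.
  - by move=> s a t /(hE y)/(hE x).
  - by rewrite /= !hr mulE.
have h1 v : vertices G v -> h one v = v.
  move=> vV; apply: (edge_preserving_unique (g := id) detG _ _ (rG v vV)) => //.
  - exact: hE.
  - by rewrite hr.
(* The right inverse of [x] is the preimage of [r] under [h x]. *)
have /choice[inv mulV] (x : T) : exists y, mul x y = one.
  have [[_ _ /(_ r rV)[v vV hxv]] _] := (hP x).1.
  by have [y yv] := mkT v vV; exists y; apply: val_inj; rewrite [LHS]mulE yv hxv.
have mulA : associative mul.
  by move=> x y z; apply: val_inj; rewrite [LHS]mulE [RHS]mulE mulE hM.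
have mul1 : left_id one mul by move=> x; apply: val_inj; rewrite [LHS]mulE h1.
have mulr1 : right_id one mul.
  by move=> x; apply: val_inj; rewrite [LHS]mulE oneE hr.
have [gT [mulgE oneg]] := group_structure mulA mul1 mulr1 mulV.
exists (vertices G), gT; set gr : groupType := Group.Pack gT => /=.
pose Q : set gr := [set q : T | edge G r (set_val q)].
have /choice[lab labP] (q : Q) : exists a, G (r, a, set_val (set_val q : T)).
  exact: set_valP q.
(* An edge leaving [x] is pulled back along [h x] to an edge leaving [r]. Its target is the
   generator [q], and simplicity identifies its label with the chosen [lab q]. *)
have edgeM (x : T) a t : G (set_val x, a, t) ->
    exists q : Q, a = lab q /\ t = set_val (mul x (set_val q)).
  move=> Gxt; have [xV tV] := edge_vertices Gxt.
  have [[_ _ /(_ t tV)[v vV hxv]] hxG] := (hP x).1.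
  have Grv : G (r, a, v) by apply/(hxG r a v rV vV); rewrite hr hxv.
  have [y yv] := mkT v vV.
  have /mem_set Qy : Q y by exists a; rewrite yv.
  exists (SigSub Qy); rewrite mulE; split; last by rewrite -hxv -yv.
  apply: simG Grv _; rewrite -yv; exact: (labP (SigSub Qy)).
exists Q, lab; split.
- move=> x.
  (* The start [y] is left arbitrary so that the transitivity case can concatenate the two words. *)
  have path_prod s t : clos_refl_trans V (edge G) s t -> forall y : gr,
      s = @set_val V (vertices G) y -> exists2 l : seq gr,
      {in l, forall z, Q z} &
      t = @set_val V (vertices G) (y * \prod_(z <- l) z)%g.
    elim=> {s t} [s t [a st] y sy|s y ->|s t u _ IHst _ IHtu y sy].
    + rewrite sy in st; have [q [_ ->]] := edgeM _ _ _ st.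
      exists [:: set_val q] => [z|]; last by rewrite big_seq1 mulgE.
      by rewrite inE => /eqP ->; exact: set_valP.
    + by exists [::] => //; rewrite big_nil mulg1.
    + have [l lQ /IHtu[l' l'Q ->]] := IHst _ sy.
      exists (l ++ l'); last by rewrite big_cat mulgA.
      by move=> z; rewrite mem_cat => /orP[/lQ|/l'Q].
  have [|l lQ xl] := path_prod _ _ (rG _ (TV x)) 1%g; first by rewrite oneg oneE.
  by exists l => //; apply: val_inj; rewrite mul1g in xl.
(* Equal labels give two edges from [r] with the same label, so their targets agree. *)
- move=> q q' qq'; apply/val_inj/val_inj; apply: detG (labP q) _.
  by rewrite qq'; exact: labP.
- apply/seteqP; split=> [[[s a] t] Gst|_ [_ [p [q ->]] <-]] /=.
    have [x xs] := mkT _ (edge_vertices Gst).1.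
    rewrite -xs in Gst *; have [q [-> ->]] := edgeM _ _ _ Gst.
    exists ((x : gr), lab q, ((x : gr) * set_val q)%g); first by exists x, q.
    by rewrite /= mulgE.
  (* This edge is the image under [h p] of the edge from [r] to [q]. *)
  by rewrite mulgE mulE -hr; exact: hE.
Qed.

End RegularAction.

Theorem theorem4p4 (V A : Type) (G : graph V A) (G_neq0 : G !=set0) :
  group_monoid_cayley G <->
  [/\ rooted_graph G, simple_graph G, deterministic_graph G & symmetric_graph G].
Proof.
split=> [[M [gM [Q [lab [genQ lab_inj GE]]]]]|[? ? ? ?]]; last first.
  exact: regular_group_monoid_cayley.
rewrite GE in G_neq0 *; split.
- exact: cayley_rooted.
- exact: cayley_simple.
- exact: cayley_deterministic.
- exact: cayley_symmetric.
Qed.
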